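(* If $\hat\rho_1\in\mathcal A_1$ (i.e. $\rho_1$ is $G$-invariant), then $$\lim_{n\to\infty}\frac1n\log P_{\min}(\rho_0^{\otimes n}:\rho_1^{\otimes n})\le\liminf_{n\to\infty}\frac1n\log P_{\min}(\rho_{0,n}:\rho_{1,n})\le\limsup_{n\to\infty}\frac1n\log P_{\min}(\rho_{0,n}:\rho_{1,n})\le\frac12\lim_{n\to\infty}\frac1n\log P_{\min}(\rho_0^{\otimes n}:\rho_1^{\otimes n}).$$
   Context: Let $\mathcal H$ be a finite-dimensional complex Hilbert space, $G$ a compact group and $g\mapsto u_g$ a continuous unitary representation of $G$ on $\mathcal H$. For $n\in\mathbb N$ let $\mathcal A_n=\{A\in\mathcal B(\mathcal H^{\otimes n}):Au_g^{\otimes n}=u_g^{\otimes n}A\ \forall g\in G\}$ and $E_{\mathcal A_n}(X)=\int_G u_g^{\otimes n}Xu_g^{*\otimes n}\,dg$ (normalized Haar measure). Let $\rho_0,\rho_1$ be states on $\mathcal B(\mathcal H)$ with densities $\hat\rho_0,\hat\rho_1$, and $\hat\rho_{k,n}:=E_{\mathcal A_n}(\hat\rho_k^{\otimes n})$. Define $P_{\min}(\rho_{0,n}:\rho_{1,n}):=\min\{\operatorname{Tr}\hat\rho_0^{\otimes n}(I-T)+\operatorname{Tr}\hat\rho_1^{\otimes n}T:\ T\in\mathcal A_n,\ 0\le T\le I\}$ and $P_{\min}(\rho_0^{\otimes n}:\rho_1^{\otimes n}):=\min\{\operatorname{Tr}\hat\rho_0^{\otimes n}(I-T)+\operatorname{Tr}\hat\rho_1^{\otimes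 n}T:\ T\in\mathcal B(\mathcal H^{\otimes n}),\ 0\le T\le I\}$. The limit $\lim_n\frac1n\log P_{\min}(\rho_0^{\otimes n}:\rho_1^{\otimes n})$ exists (and equals $\min_{0\le s\le1}\log\operatorname{Tr}\hat\rho_0^s\hat\rho_1^{1-s}$, by the quantum Chernoff bound). *)

(* Defs.v *)
(* Complex numbers are R[i] (real_closed
   complex) over an abstract R : realType; n-fold tensor powers are
   ntensmx (A ^t n) from real_closed/mxtens. *)
From HB Require Import structures.
From mathcomp Require Import all_boot all_order all_algebra.
From mathcomp Require Import complex mxtens.
From mathcomp Require Import all_classical all_reals all_analysis.
Set Implicit Arguments. Unset Strict Implicit. Unset Printing Implicit Defensive.
Import Order.TTheory GRing.Theory Num.Theory.
Local Open Scope ring_scope.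
Local Open Scope classical_set_scope.

Section QDefs.
Variable R : realType.
Local Notation C := R[i].

Definition adjmx m n (A : 'M[C]_(m, n)) : 'M[C]_(n, m) := (map_mx Num.conj A)^T.

Definition psdmx n (A : 'M[C]_n) : Prop :=
  A = adjmx A /\ forall v : 'rV[C]_n, 0 <= (v *m A *m adjmx v) 0 0.

Definition density d (rho : 'M[C]_d) : Prop := psdmx rho /\ \tr rho = 1.

Definition compact_unitary_rep (G : topologicalType) (mul : G -> G -> G)
  (inv : G -> G) (e : G) d (u : G -> 'M[C]_d) : Prop :=
  ((forall x y z, mul x (mul y z) = mul (mul x y) z) /\
   (forall x, mul e x = x /\ mul x e = x) /\
   (forall x, mul (inv x) x = e /\ mul x (inv x) = e)) /\
  (continuous (fun p : G * G => mul p.1 p.2) /\ continuous inv) /\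
  (hausdorff_space G /\ compact [set: G]) /\
  ((forall x y, u (mul x y) = u x *m u y) /\ u e = 1%:M) /\
  (forall x, u x *m adjmx (u x) = 1%:M) /\
  (forall i j, continuous (fun x : G => (complex.Re (u x i j) : R^o)) /\
               continuous (fun x : G => (complex.Im (u x i j) : R^o))).

Definition in_An d (G : Type) (u : G -> 'M[C]_d) n (T : 'M[C]_(d ^ n)) : Prop :=
  forall g, T *m (u g ^t n) = (u g ^t n) *m T.

(* Tr rho0^{(x)n} (I - T) + Tr rho1^{(x)n} T  (a real number for 0<=T<=I) *)
Definition perr d n (r0 r1 : 'M[C]_d) (T : 'M[C]_(d ^ n)) : R :=
  complex.Re (\tr (r0 ^t n *m (1%:M - T)) + \tr (r1 ^t n *m T)).

Definition Pmin_full d (r0 r1 : 'M[C]_d) n : R :=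
  inf [set perr r0 r1 T | T in [set T : 'M[C]_(d ^ n) | psdmx T /\ psdmx (1%:M - T)]].

(* P_min(rho_{0,n} : rho_{1,n}) : minimum over tests 0 <= T <= I with T in A_n *)
Definition Pmin_inv d (G : Type) (u : G -> 'M[C]_d) (r0 r1 : 'M[C]_d) n : R :=
  inf [set perr r0 r1 T | T in
        [set T : 'M[C]_(d ^ n) | [/\ in_An u T, psdmx T & psdmx (1%:M - T)]]].

Definition elog (x : R) : \bar R := if 0 < x then (ln x)%:E else -oo%E.

Definition rate (P : nat -> R) (n : nat) : \bar R := (((n%:R)^-1)%:E * elog (P n))%E.

End QDefs.

(* Main.v *)
(* Every test [T] can be replaced by a [G]-invariant one at the price of a square root and
   of a factor polynomial in [n].  Let [M] be the algebra spanned by the [u_g ^t n], so that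
   [A_n] is its commutant, and let [S] be the Hilbert-Schmidt projection of [T] onto [A_n],
   which is the Haar average of [T].  Then [S] is positive, [Tr rho1^{(x)n} S = Tr rho1^{(x)n} T]
   by invariance of [rho1], and [T <= k S] with [k = dim M]: for [T = w^* w] one has
   [T <= Tr(T S^+) S], where [S^+] is the pseudo-inverse of [S], and [Tr(T S^+) <= dim (w M)].
   The spectral projection [T'] of [S] on the eigenvalues above [lam] is invariant, with
   [T' <= S / lam] and [1 - T' <= 2 (1 - T) + 2 k lam].  Taking for [lam] the square root of
   the optimal error [P] gives an invariant error of at most [5 k sqrt P], and [k] is
   polynomial in [n] because the entries of [u_g ^t n] are monomials of degree [n] in those
   of [u_g]. *)
Require Import Defs.
From HB Require Import structures.
From mathcomp Require Import all_boot all_order all_algebra.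
From mathcomp Require Import complex mxtens.
From mathcomp Require Import all_classical all_reals all_analysis.
From mathcomp Require Import ring lra zify.
Set Implicit Arguments. Unset Strict Implicit. Unset Printing Implicit Defensive.
Import Order.TTheory GRing.Theory Num.Theory numFieldNormedType.Exports.
Local Open Scope ring_scope.

(** * Adjoints, real traces and the Loewner order *)

Section RealTrace.
Variable R : realType.
Local Notation C := R[i].

Lemma adjmxM m n p (A : 'M[C]_(m, n)) (B : 'M[C]_(n, p)) :
  adjmx (A *m B) = adjmx B *m adjmx A.
Proof. by rewrite /adjmx map_mxM trmx_mul. Qed.

Lemma adjmxK m n (A : 'M[C]_(m, n)) : adjmx (adjmx A) = A.
Proof. by apply/matrixP => i j; rewrite !mxE conjCK. Qed.

Lemma adjmxD m n (A B : 'M[C]_(m, n)) : adjmx (A + B) = adjmx A + adjmx B.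
Proof. by apply/matrixP => i j; rewrite !mxE rmorphD. Qed.

Lemma adjmxB m n (A B : 'M[C]_(m, n)) : adjmx (A - B) = adjmx A - adjmx B.
Proof. by apply/matrixP => i j; rewrite !mxE rmorphB. Qed.

Lemma adjmxZ m n a (A : 'M[C]_(m, n)) : adjmx (a *: A) = Num.conj a *: adjmx A.
Proof. by apply/matrixP => i j; rewrite !mxE rmorphM. Qed.

Lemma adjmxZ_real m n (a : R) (A : 'M[C]_(m, n)) :
  adjmx (a%:C%C *: A) = a%:C%C *: adjmx A.
Proof. by rewrite adjmxZ; congr (_ *: _); exact: conjc_real. Qed.

Lemma adjmx1 n : adjmx (1%:M : 'M[C]_n) = 1%:M.
Proof. by rewrite /adjmx map_mx1 trmx1. Qed.

Definition selfadj n (A : 'M[C]_n) : Prop := adjmx A = A.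

Lemma selfadj1 n : selfadj (1%:M : 'M[C]_n).
Proof. exact: adjmx1. Qed.

Lemma selfadjD n (A B : 'M[C]_n) : selfadj A -> selfadj B -> selfadj (A + B).
Proof. by rewrite /selfadj adjmxD => -> ->. Qed.

Lemma selfadjB n (A B : 'M[C]_n) : selfadj A -> selfadj B -> selfadj (A - B).
Proof. by rewrite /selfadj adjmxB => -> ->. Qed.

Lemma selfadjZ n (a : R) (A : 'M[C]_n) : selfadj A -> selfadj (a%:C%C *: A).
Proof. by rewrite /selfadj adjmxZ_real => ->. Qed.

Definition retr n (A : 'M[C]_n) : R := complex.Re (\tr A).

HB.instance Definition _ n :=
  GRing.Additive.copy (@retr n) (@complex.Re R \o @mxtrace C n).

Lemma retrZ n (a : R) (A : 'M[C]_n) : retr (a%:C%C *: A) = a * retr A.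
Proof. by rewrite /retr mxtraceZ; case: (\tr A) => x y /=; rewrite mul0r subr0. Qed.

Lemma retr1 n : retr (1%:M : 'M[C]_n) = n%:R.
Proof. by rewrite /retr mxtrace1 -[_%:R](rmorph_nat (real_complex R)). Qed.

Lemma retr_mulC m n (A : 'M[C]_(m, n)) (B : 'M[C]_(n, m)) : retr (A *m B) = retr (B *m A).
Proof. by rewrite /retr mxtrace_mulC. Qed.

Lemma mxtrace_adj n (A : 'M[C]_n) : \tr (adjmx A) = Num.conj (\tr A).
Proof. by rewrite /adjmx mxtrace_tr trace_map_mx. Qed.

Lemma retr_adj n (A : 'M[C]_n) : retr (adjmx A) = retr A.
Proof. by rewrite /retr mxtrace_adj; case: (\tr A). Qed.

Lemma retr_mul_adjE m n (A : 'M[C]_(m, n)) :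
  retr (A *m adjmx A) = \sum_i \sum_j complex.Re (A i j * Num.conj (A i j)).
Proof.
rewrite /retr /mxtrace raddf_sum; apply: eq_bigr => i _.
by rewrite mxE raddf_sum; apply: eq_bigr => j _; rewrite !mxE.
Qed.

Lemma Re_mul_conj_ge0 (z : C) : 0 <= complex.Re (z * Num.conj z).
Proof. by have := mul_conjC_ge0 z; rewrite lecE => /andP[]. Qed.

Lemma retr_mul_adj_ge0 m n (A : 'M[C]_(m, n)) : 0 <= retr (A *m adjmx A).
Proof.
by rewrite retr_mul_adjE; do 2 apply: sumr_ge0 => ? _; exact: Re_mul_conj_ge0.
Qed.

Lemma retr_mul_adj_eq0 m n (A : 'M[C]_(m, n)) : retr (A *m adjmx A) = 0 -> A = 0.
Proof.
rewrite retr_mul_adjE => /psumr_eq0P rows0; apply/matrixP => i j; rewrite mxE.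
have /psumr_eq0P entries0 : \sum_j complex.Re (A i j * Num.conj (A i j)) = 0.
  by apply: rows0 => // k _; apply: sumr_ge0 => l _; exact: Re_mul_conj_ge0.
have := entries0 (fun l _ => Re_mul_conj_ge0 (A i l)) j isT.
case: (A i j) => a b /= ab0.
have -> : a = 0 by nra.
by have -> : b = 0 by nra.
Qed.

Definition mxform m n (A : 'M[C]_n) (x y : 'M[C]_(m, n)) : R :=
  retr (x *m A *m adjmx y).

Lemma mxform_mxD m n (A B : 'M[C]_n) (x y : 'M[C]_(m, n)) :
  mxform (A + B) x y = mxform A x y + mxform B x y.
Proof. by rewrite /mxform mulmxDr mulmxDl raddfD. Qed.

Lemma mxform_mxB m n (A B : 'M[C]_n) (x y : 'M[C]_(m, n)) :
  mxform (A - B) x y = mxform A x y - mxform B x y.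
Proof. by rewrite /mxform mulmxBr mulmxBl raddfB. Qed.

Lemma mxform_mx_sum m n (I : finType) (F : I -> 'M[C]_n) (x y : 'M[C]_(m, n)) :
  mxform (\sum_i F i) x y = \sum_i mxform (F i) x y.
Proof. by rewrite /mxform mulmx_sumr mulmx_suml raddf_sum. Qed.

Lemma mxform_mxZ m n (a : R) (A : 'M[C]_n) (x y : 'M[C]_(m, n)) :
  mxform (a%:C%C *: A) x y = a * mxform A x y.
Proof. by rewrite /mxform -scalemxAr -scalemxAl retrZ. Qed.

Lemma mxform_sym m n (A : 'M[C]_n) (x y : 'M[C]_(m, n)) :
  selfadj A -> mxform A x y = mxform A y x.
Proof. by move=> A_selfadj; rewrite /mxform -retr_adj !adjmxM adjmxK A_selfadj mulmxA. Qed.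

Lemma mxformBZl m n (A : 'M[C]_n) (a : R) (x y z : 'M[C]_(m, n)) :
  mxform A (x - a%:C%C *: y) z = mxform A x z - a * mxform A y z.
Proof. by rewrite /mxform !mulmxBl raddfB /= -!scalemxAl retrZ. Qed.

Lemma mxform_sqrB m n (A : 'M[C]_n) (a : R) (x y : 'M[C]_(m, n)) : selfadj A ->
  mxform A (x - a%:C%C *: y) (x - a%:C%C *: y) =
  mxform A x x - 2 * a * mxform A x y + a ^+ 2 * mxform A y y.
Proof.
move=> A_selfadj; rewrite mxformBZl (mxform_sym x _ A_selfadj) (mxform_sym y _ A_selfadj).
by rewrite !mxformBZl (mxform_sym y x A_selfadj); ring.
Qed.

Lemma psdmx_selfadj n (A : 'M[C]_n) : psdmx A -> selfadj A.
Proof. by case. Qed.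

Lemma psdmxP n (A : 'M[C]_n) :
  psdmx A <-> selfadj A /\ forall x : 'rV_n, 0 <= mxform A x x.
Proof.
have trE (x : 'rV_n) : (x *m A *m adjmx x) 0 0 = \tr (x *m A *m adjmx x).
  by rewrite /mxtrace big_ord1.
split=> -[A_selfadj A_ge0]; split=> // x.
  by have := A_ge0 x; rewrite trE lecE => /andP[].
have xAx_real : \tr (x *m A *m adjmx x) \is Num.real.
  by apply/CrealP; rewrite -mxtrace_adj !adjmxM adjmxK A_selfadj mulmxA.
by rewrite trE -(RRe_real xAx_real) lecR; exact: A_ge0.
Qed.

Lemma psdmx_gram m n (Y : 'M[C]_(m, n)) : psdmx (adjmx Y *m Y).
Proof.
apply/psdmxP; split=> [|x]; first by rewrite /selfadj adjmxM adjmxK.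
by have := retr_mul_adj_ge0 (x *m adjmx Y); rewrite /mxform adjmxM adjmxK !mulmxA.
Qed.

Lemma psdmx0 n : psdmx (0 : 'M[C]_n).
Proof. by have := psdmx_gram (0 : 'M[C]_n); rewrite mulmx0. Qed.

Lemma psdmx1 n : psdmx (1%:M : 'M[C]_n).
Proof. by have := psdmx_gram (1%:M : 'M[C]_n); rewrite mulmx1 adjmx1. Qed.

Lemma mxform_rowE m n (A : 'M[C]_n) (x : 'M[C]_(m, n)) i :
  mxform A (row i x) (row i x) = complex.Re ((x *m A *m adjmx x) i i).
Proof.
rewrite /mxform /retr /mxtrace big_ord1 -row_mul !mxE; congr (complex.Re _).
by apply: eq_bigr => j _; rewrite !mxE.
Qed.

Lemma psdmx_form_ge0 m n (A : 'M[C]_n) (x : 'M[C]_(m, n)) : psdmx A -> 0 <= mxform A x x.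
Proof.
move=> /psdmxP[_ A_ge0].
have -> : mxform A x x = \sum_i mxform A (row i x) (row i x).
  by rewrite {1}/mxform /retr /mxtrace raddf_sum; apply: eq_bigr => i _; rewrite mxform_rowE.
exact: sumr_ge0.
Qed.

Lemma psdmx_congr m n (A : 'M[C]_n) (x : 'M[C]_(m, n)) :
  psdmx A -> psdmx (x *m A *m adjmx x).
Proof.
move=> A_psd; apply/psdmxP; split=> [|y].
  by rewrite /selfadj !adjmxM adjmxK (psdmx_selfadj A_psd) mulmxA.
by have := psdmx_form_ge0 (y *m x) A_psd; rewrite /mxform adjmxM !mulmxA.
Qed.

End RealTrace.

Definition lemx (R : realType) n (A B : 'M[R[i]]_n) : Prop := psdmx (B - A).
Local Notation "A <=m B" := (lemx A B) (at level 70).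

Lemma mxform_lemx (R : realType) m n (A B : 'M[R[i]]_n) (x : 'M[R[i]]_(m, n)) :
  A <=m B -> mxform A x x <= mxform B x x.
Proof. by move=> /(psdmx_form_ge0 x); rewrite mxform_mxB subr_ge0. Qed.

Lemma lemx_mxform (R : realType) n (A B : 'M[R[i]]_n) : selfadj A -> selfadj B ->
  (forall x : 'rV_n, mxform A x x <= mxform B x x) -> A <=m B.
Proof.
move=> A_selfadj B_selfadj AB; apply/psdmxP; split=> [|x]; first exact: selfadjB.
by rewrite mxform_mxB subr_ge0.
Qed.

(** * Functional calculus of self-adjoint matrices *)

Lemma comm_diag_mx (F : fieldType) n (d d' : 'rV[F]_n) (B : 'M[F]_n) :
  (forall i j, d 0 i = d 0 j -> d' 0 i = d' 0 j) ->
  comm_mx (diag_mx d) B -> comm_mx (diag_mx d') B.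
Proof.
move=> dd' /matrixP dB; apply/matrixP => i j.
have := dB i j; rewrite !(mul_diag_mx, mul_mx_diag) !mxE.
have [/dd' -> _|neq_ij] := eqVneq (d 0 i) (d 0 j); first exact: mulrC.
move/eqP; rewrite mulrC -subr_eq0 -mulrBr mulf_eq0 subr_eq0 (negPf neq_ij) orbF.
by move/eqP=> ->; rewrite mul0r mulr0.
Qed.

Section FunctionalCalculus.
Variable R : realType.
Local Notation C := R[i].

Lemma adjmxE m n (A : 'M[C]_(m, n)) : adjmx A = (A ^t* )%sesqui.
Proof. by rewrite /adjmx map_trmx. Qed.

Lemma unitarymx_mul_adj m n (A : 'M[C]_(m, n)) : A \is unitarymx -> A *m adjmx A = 1%:M.
Proof. by rewrite adjmxE => /unitarymxP. Qed.

Lemma adjmx_diag n (d : 'I_n -> R) :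
  adjmx (diag_mx (\row_i (d i)%:C%C) : 'M[C]_n) = diag_mx (\row_i (d i)%:C%C).
Proof.
apply/matrixP => i j; rewrite !mxE rmorphMn eq_sym.
by case: eqVneq => [->|//]; rewrite !mulr1n; exact: conjc_real.
Qed.

Definition eigval n (A : 'M[C]_n) (i : 'I_n) : R := complex.Re (spectral_diag A 0 i).

(* The spectral decomposition of a matrix that is not normal is trivial, so that [mxfun]
   is only meaningful on normal matrices. *)
Definition mxfun (f : R -> R) n (A : 'M[C]_n) : 'M[C]_n :=
  adjmx (spectralmx A) *m diag_mx (\row_i (f (eigval A i))%:C%C) *m spectralmx A.

Variables (n : nat) (A : 'M[C]_n).
Implicit Types f g : R -> R.

Let P := spectralmx A.

Let mul_spectralmx_adj : P *m adjmx P = 1%:M.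
Proof. exact/unitarymx_mul_adj/spectral_unitarymx. Qed.

Let mul_adj_spectralmx : adjmx P *m P = 1%:M.
Proof. exact: mulmx1C. Qed.

Lemma eq_mxfun f g : (forall i, f (eigval A i) = g (eigval A i)) -> mxfun f A = mxfun g A.
Proof.
by move=> fg; congr (_ *m diag_mx _ *m _); apply/rowP => i; rewrite !mxE fg.
Qed.

Lemma mxfun_cst a : mxfun (fun=> a) A = a%:C%C%:M.
Proof.
rewrite /mxfun -/P (_ : (\row__ _) = const_mx a%:C%C); last by apply/rowP => i; rewrite !mxE.
by rewrite diag_const_mx mul_mx_scalar -scalemxAl mul_adj_spectralmx scalemx1.
Qed.

Lemma mxfunB f g : mxfun (fun s => f s - g s) A = mxfun f A - mxfun g A.
Proof.
rewrite /mxfun -mulmxBl -mulmxBr -raddfB /=; congr (_ *m diag_mx _ *m _).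
by apply/rowP => i; rewrite !mxE rmorphB.
Qed.

Lemma mxfunN f : mxfun (fun s => - f s) A = - mxfun f A.
Proof.
rewrite /mxfun -mulNmx -mulmxN -raddfN /=; congr (_ *m diag_mx _ *m _).
by apply/rowP => i; rewrite !mxE rmorphN.
Qed.

Lemma mxfunZ a f : mxfun (fun s => a * f s) A = a%:C%C *: mxfun f A.
Proof.
rewrite /mxfun scalemxAl scalemxAr -linearZ /=; congr (_ *m diag_mx _ *m _).
by apply/rowP => i; rewrite !mxE rmorphM.
Qed.

Let to_spectral (B : 'M[C]_n) := P *m B *m adjmx P.
Let of_spectral (B : 'M[C]_n) := adjmx P *m B *m P.

Let mxfunE f : mxfun f A = of_spectral (diag_mx (\row_i (f (eigval A i))%:C%C)).
Proof. by []. Qed.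

Let of_spectralK : cancel of_spectral to_spectral.
Proof.
move=> B; rewrite /to_spectral /of_spectral !mulmxA mul_spectralmx_adj mul1mx.
by rewrite -mulmxA mul_spectralmx_adj mulmx1.
Qed.

Let to_spectralK : cancel to_spectral of_spectral.
Proof.
move=> B; rewrite /to_spectral /of_spectral !mulmxA mul_adj_spectralmx mul1mx.
by rewrite -mulmxA mul_adj_spectralmx mulmx1.
Qed.

Let of_spectralM B D : of_spectral (B *m D) = of_spectral B *m of_spectral D.
Proof.
by rewrite /of_spectral -!mulmxA (mulmxA P (adjmx P)) mul_spectralmx_adj mul1mx.
Qed.

Lemma mxfunM f g : mxfun (fun s => f s * g s) A = mxfun f A *m mxfun g A.
Proof.
rewrite !mxfunE -of_spectralM mulmx_diag; congr (of_spectral (diag_mx _)).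
by apply/rowP => i; rewrite !mxE rmorphM.
Qed.

Lemma mxfun_selfadj f : selfadj (mxfun f A).
Proof. by rewrite /selfadj /mxfun !adjmxM adjmxK adjmx_diag mulmxA. Qed.

Lemma retr_mxfun f : retr (mxfun f A) = \sum_i f (eigval A i).
Proof.
rewrite /mxfun -/P -mulmxA retr_mulC -mulmxA mul_spectralmx_adj mulmx1.
by rewrite /retr mxtrace_diag raddf_sum; apply: eq_bigr => i _; rewrite mxE.
Qed.

Lemma mxfun_psd f : (forall i, 0 <= f (eigval A i)) -> psdmx (mxfun f A).
Proof.
move=> f_ge0; pose h s := Num.sqrt (f s).
have -> : mxfun f A = mxfun (fun s => h s * h s) A.
  by apply: eq_mxfun => i; rewrite -expr2 sqr_sqrtr.
by rewrite mxfunM -{1}(mxfun_selfadj h); exact: psdmx_gram.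
Qed.

Lemma le_mxfun f g : (forall i, f (eigval A i) <= g (eigval A i)) ->
  mxfun f A <=m mxfun g A.
Proof. by move=> fg; rewrite /lemx -mxfunB; apply: mxfun_psd => i; rewrite subr_ge0. Qed.

Hypothesis A_selfadj : selfadj A.

Lemma mxfun_id : mxfun id A = A.
Proof.
have A_herm : A \is hermsymmx by rewrite is_hermitianmxE expr0 scale1r -adjmxE A_selfadj.
rewrite [RHS](orthomx_spectralP (hermitian_normalmx A_herm)).
rewrite (invmx_unitary (spectral_unitarymx A)) -adjmxE mxfunE.
have /mxOverP eig_real := hermitian_spectral_diag_real A_herm.
by rewrite (_ : \row_i _ = spectral_diag A) //; apply/rowP => i; rewrite mxE RRe_real.
Qed.

Lemma mxfun_comm f (B : 'M[C]_n) : comm_mx A B -> comm_mx (mxfun f A) B.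
Proof.
rewrite /comm_mx -{1 2}mxfun_id -[B]to_spectralK !mxfunE -!of_spectralM.
move/(can_inj of_spectralK) => AB; congr of_spectral.
by apply: comm_diag_mx AB => i j; rewrite !mxE => /(@complexI R) ->.
Qed.

End FunctionalCalculus.

(** * Positive semidefinite matrices *)

Section PositiveMatrices.
Variable R : realType.
Local Notation C := R[i].
Implicit Types (m n : nat).

Lemma psdmx_eigval_ge0 n (A : 'M[C]_n) i : psdmx A -> 0 <= eigval A i.
Proof.
move=> A_psd; set P := spectralmx A; set D := diag_mx (\row_i (eigval A i)%:C%C).
have PP : P *m adjmx P = 1%:M by exact/unitarymx_mul_adj/spectral_unitarymx.
have DE : D = P *m A *m adjmx P.
  have -> : A = adjmx P *m D *m P by rewrite -[LHS](mxfun_id (psdmx_selfadj A_psd)).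
  by rewrite !mulmxA PP mul1mx -mulmxA PP mulmx1.
have -> : eigval A i = mxform A (row i P) (row i P).
  by rewrite mxform_rowE -DE !mxE eqxx.
exact: psdmx_form_ge0.
Qed.

Definition mxsqrt n (A : 'M[C]_n) : 'M[C]_n := mxfun Num.sqrt A.

Lemma mxsqrt_mul n (A : 'M[C]_n) : psdmx A -> mxsqrt A *m mxsqrt A = A.
Proof.
move=> A_psd; rewrite -mxfunM -[RHS](mxfun_id (psdmx_selfadj A_psd)).
by apply: eq_mxfun => i; rewrite -expr2 sqr_sqrtr ?psdmx_eigval_ge0.
Qed.

Lemma psdmx_factor n (A : 'M[C]_n) : psdmx A -> exists Y : 'M[C]_n, A = adjmx Y *m Y.
Proof. by move=> A_psd; exists (mxsqrt A); rewrite mxfun_selfadj mxsqrt_mul. Qed.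

Lemma retr_psdmx_mul_ge0 n (A B : 'M[C]_n) : psdmx A -> psdmx B -> 0 <= retr (A *m B).
Proof.
move=> /psdmx_factor[Y ->] B_psd; rewrite -mulmxA retr_mulC.
exact: psdmx_form_ge0.
Qed.

Lemma ler_retr_mull n (A B D : 'M[C]_n) : psdmx D -> A <=m B ->
  retr (D *m A) <= retr (D *m B).
Proof.
move=> D_psd /(retr_psdmx_mul_ge0 D_psd).
by rewrite mulmxBr raddfB subr_ge0.
Qed.

Definition orthoprojmx n (E : 'M[C]_n) : Prop := selfadj E /\ E *m E = E.

Definition spectral_proj (b : pred R) n (A : 'M[C]_n) : 'M[C]_n :=
  mxfun (fun s => (b s)%:R) A.

Lemma spectral_proj_orthoprojmx b n (A : 'M[C]_n) : orthoprojmx (spectral_proj b A).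
Proof.
split; first exact: mxfun_selfadj.
by rewrite -mxfunM; apply: eq_mxfun => i; rewrite -natrM mulnb andbb.
Qed.

Lemma spectral_proj_psd b n (A : 'M[C]_n) : psdmx (spectral_proj b A).
Proof. by apply: mxfun_psd => i; exact: ler0n. Qed.

Lemma spectral_projC b n (A : 'M[C]_n) :
  1%:M - spectral_proj b A = spectral_proj (predC b) A.
Proof.
rewrite (_ : 1%:M = mxfun (fun=> 1) A) -?mxfunB; last by rewrite mxfun_cst rmorph1.
by apply: eq_mxfun => i /=; case: (b _); rewrite ?subrr ?subr0.
Qed.

Lemma psdmx_mul_orthoprojmx_eq0 n (A E : 'M[C]_n) : psdmx A -> orthoprojmx E ->
  retr (A *m E) = 0 -> A *m E = 0.
Proof.
move=> /psdmx_factor[Y ->] [E_selfadj EE] trAE0.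
have YE0 : Y *m E = 0.
  apply: retr_mul_adj_eq0.
  by rewrite adjmxM E_selfadj -mulmxA (mulmxA E) EE mulmxA retr_mulC mulmxA.
by rewrite -mulmxA YE0 mulmx0.
Qed.

Lemma psdmx_le_retr n (A : 'M[C]_n) : psdmx A -> A <=m (retr A)%:C%C%:M.
Proof.
move=> A_psd; have A_id := mxfun_id (psdmx_selfadj A_psd).
rewrite -{1}A_id -(mxfun_cst A); apply: le_mxfun => i.
rewrite -A_id retr_mxfun A_id (bigD1 i) //= lerDl.
by apply: sumr_ge0 => j _; exact: psdmx_eigval_ge0.
Qed.

(* [mxpinv] relies on the convention [0^-1 = 0]. *)
Definition mxpinv n (A : 'M[C]_n) : 'M[C]_n := mxfun (fun s => s^-1) A.

Definition mxsupp n (A : 'M[C]_n) : 'M[C]_n := spectral_proj (predC1 0) A.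

Lemma mxpinv_mul n (A : 'M[C]_n) : selfadj A -> mxpinv A *m A = mxsupp A.
Proof.
move=> A_selfadj; rewrite -{2}[A](mxfun_id A_selfadj) -mxfunM; apply: eq_mxfun => i /=.
by case: (eqVneq (eigval A i) 0) => [->|s_neq0]; rewrite ?mulr0 ?mulVf.
Qed.

Lemma mul_mxsupp n (A : 'M[C]_n) : selfadj A -> A *m mxsupp A = A.
Proof.
move=> A_selfadj; rewrite -{1 3}[A](mxfun_id A_selfadj) -mxfunM; apply: eq_mxfun => i /=.
by case: (eqVneq (eigval A i) 0) => [->|_]; rewrite ?mulr0 ?mulr1.
Qed.

Lemma psdmx_le_retr_mxpinv n (A B : 'M[C]_n) : psdmx A -> psdmx B -> A *m mxsupp B = A ->
  A <=m (retr (A *m mxpinv B))%:C%C *: B.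
Proof.
move=> A_psd B_psd AsuppB; set r := mxsqrt B.
set q := mxfun (fun s => (Num.sqrt s)^-1) B.
have r_selfadj : selfadj r by exact: mxfun_selfadj.
have q_selfadj : selfadj q by exact: mxfun_selfadj.
have qr : q *m r = mxsupp B.
  rewrite -mxfunM; apply: eq_mxfun => i /=.
  have [->|s_neq0] := eqVneq (eigval B i) 0; first by rewrite sqrtr0 mulr0.
  by rewrite mulVf // sqrtr_eq0 -ltNge lt0r s_neq0 psdmx_eigval_ge0.
have rq : r *m q = mxsupp B by rewrite -qr -!mxfunM; apply: eq_mxfun => i; exact: mulrC.
have qq : q *m q = mxpinv B.
  rewrite -mxfunM; apply: eq_mxfun => i /=.
  by rewrite -invfM -expr2 sqr_sqrtr // psdmx_eigval_ge0.
have suppBA : mxsupp B *m A = A.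
  have /(congr1 (@adjmx _ _ _)) := AsuppB.
  by rewrite adjmxM mxfun_selfadj (psdmx_selfadj A_psd).
have rr : r *m r = B := mxsqrt_mul B_psd.
have qAq_psd : psdmx (q *m A *m q) by have := psdmx_congr q A_psd; rewrite q_selfadj.
have trE : retr (q *m A *m q) = retr (A *m mxpinv B).
  by rewrite retr_mulC mulmxA qq retr_mulC.
have := psdmx_congr r (psdmx_le_retr qAq_psd); rewrite r_selfadj trE.
move: (retr _)%:C%C => c; clearbody r q.
have rqAqr : r *m (q *m A *m q) *m r = A by rewrite !mulmxA rq suppBA -mulmxA qr.
by rewrite /lemx mulmxBr mulmxBl rqAqr mul_mx_scalar -scalemxAl rr.
Qed.

End PositiveMatrices.

(** * Spectral tests *)

Section SpectralTests.
Variable R : realType.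
Local Notation C := R[i].
Variable n : nat.
Implicit Types (S T : 'M[C]_n) (lam k : R).

Definition quantum_test T : Prop := psdmx T /\ psdmx (1%:M - T).

Lemma quantum_test0 : quantum_test 0.
Proof. by rewrite /quantum_test subr0; split; [exact: psdmx0 | exact: psdmx1]. Qed.

Definition spectral_test lam S : 'M[C]_n := spectral_proj (fun s => lam < s) S.

Lemma quantum_test_spectral lam S : quantum_test (spectral_test lam S).
Proof. by split; rewrite ?spectral_projC; exact: spectral_proj_psd. Qed.

Lemma spectral_test_le lam S : 0 < lam -> psdmx S ->
  spectral_test lam S <=m (lam^-1)%:C%C *: S.
Proof.
move=> lam_gt0 S_psd; rewrite -{2}[S](mxfun_id (psdmx_selfadj S_psd)) -mxfunZ.
apply: le_mxfun => i; rewrite mulrC ler_pdivlMr //.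
by case: ltP => [/ltW|_]; rewrite ?mul1r ?mul0r ?psdmx_eigval_ge0.
Qed.

(* With [y = x E], positivity of [1 - T] at [y - 2 x] and of [T] at [y - 2 c x] bounds the
   cross terms of [E = E (1 - T) + E T]. *)
Lemma proj_le_test_compl (E T : 'M[C]_n) (c : R) :
  orthoprojmx E -> quantum_test T -> 0 < c -> E *m T *m E <=m c%:C%C *: E ->
  E <=m 2%:C%C *: (1%:M - T + c%:C%C *: 1%:M).
Proof.
move=> [E_selfadj EE] [T_psd T_le1] c_gt0 ETE; have T_selfadj := psdmx_selfadj T_psd.
have id_selfadj := selfadj1 R n.
apply: lemx_mxform => // [|x].
  by apply/selfadjZ/selfadjD; [exact: selfadjB | exact: selfadjZ].
set y := x *m E.
have formE : mxform E x x = mxform 1%:M y y.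
  by rewrite /mxform mulmx1 /y adjmxM E_selfadj mulmxA -(mulmxA x E E) EE.
have form_yx : mxform 1%:M y x = mxform 1%:M y y.
  by rewrite -formE /mxform mulmx1.
have formT_y : mxform T y y <= c * mxform 1%:M y y.
  have -> : mxform T y y = mxform (E *m T *m E) x x.
    by rewrite /mxform /y adjmxM E_selfadj !mulmxA.
  by rewrite -formE -mxform_mxZ; exact: mxform_lemx.
have Ty_ge0 : 0 <= mxform T y y by exact: psdmx_form_ge0.
have Tx_le := mxform_lemx x T_le1.
have T_ge0 := psdmx_form_ge0 (y - (2 * c)%:C%C *: x) T_psd.
rewrite (mxform_sqrB _ _ _ T_selfadj) in T_ge0.
have compl_ge0 := psdmx_form_ge0 (y - 2%:C%C *: x) T_le1.
rewrite (mxform_mxB 1%:M T) (mxform_sqrB _ _ _ id_selfadj) in compl_ge0.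
rewrite (mxform_sqrB _ _ _ T_selfadj) form_yx in compl_ge0.
rewrite formE mxform_mxZ (mxform_mxD (1%:M - T)) mxform_mxZ (mxform_mxB 1%:M T).
move: formT_y Ty_ge0 Tx_le T_ge0 compl_ge0; move: (mxform T y y) (mxform T y x) (mxform T x x).
move: (mxform 1%:M y y) (mxform 1%:M x x) => yy xx Tyy Tyx Txx Tyy_le Tyy_ge0 Txx_le T_ge0.
move=> /(mulr_ge0 (ltW c_gt0)) compl_ge0.
have cTyy_ge0 := mulr_ge0 (ltW c_gt0) Tyy_ge0.
have ccTxx_le := ler_wpM2l (mulr_ge0 (ltW c_gt0) (ltW c_gt0)) Txx_le.
by rewrite -(ler_pM2l c_gt0); lra.
Qed.

Lemma spectral_test_compl_le lam k S T :
  0 < k -> 0 < lam -> selfadj S -> quantum_test T -> T <=m k%:C%C *: S ->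
  1%:M - spectral_test lam S <=m 2%:C%C *: (1%:M - T + (k * lam)%:C%C *: 1%:M).
Proof.
move=> k_gt0 lam_gt0 S_selfadj T_test T_leS; rewrite spectral_projC.
set E := spectral_proj _ S; have E_proj : orthoprojmx E := spectral_proj_orthoprojmx _ S.
have ESE : E *m S *m E <=m lam%:C%C *: E.
  rewrite -[S in E *m S](mxfun_id S_selfadj) -!mxfunM -mxfunZ; apply: le_mxfun => i.
  rewrite /= -leNgt.
  by case: (leP (eigval S i)) => /= s_le; rewrite !(mul1r, mul0r, mulr1, mulr0).
clearbody E; have E_selfadj := E_proj.1.
have formE (B : 'M[C]_n) (x : 'rV_n) : mxform (E *m B *m E) x x = mxform B (x *m E) (x *m E).
  by rewrite /mxform adjmxM E_selfadj !mulmxA.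
apply: (proj_le_test_compl E_proj T_test (mulr_gt0 k_gt0 lam_gt0)).
apply: lemx_mxform => [||x].
- by rewrite /selfadj !adjmxM E_selfadj (psdmx_selfadj T_test.1) mulmxA.
- exact: selfadjZ.
rewrite formE; apply: le_trans (mxform_lemx _ T_leS) _.
by rewrite mxform_mxZ -formE mxform_mxZ -mulrA ler_pM2l // -mxform_mxZ mxform_lemx.
Qed.

End SpectralTests.

(** * Conditional expectation onto the commutant of a star-algebra *)

Section OrthogonalProjection.
Variable R : realType.
Local Notation C := R[i].
Variables (p n : nat) (A : 'M[C]_(p, n)).

Let B := schmidt (row_base A).

Let B_eq : (B :=: A)%MS.
Proof. exact: eqmx_trans (eqmx_schmidt_free (row_base_free A)) (eq_row_base A). Qed.

Let B_unitary : B *m adjmx B = 1%:M.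
Proof. exact/unitarymx_mul_adj/schmidt_unitarymx/rank_leq_col. Qed.

Lemma proj_ortho_schmidt : proj_ortho A = adjmx B *m B.
Proof.
have BA : (adjmx B *m B <= A)%MS by rewrite -B_eq submxMl.
rewrite -[LHS]mul1mx -[X in X *m _](subrK (adjmx B *m B)) mulmxDl (proj_ortho_id BA).
rewrite proj_ortho_0 ?add0r // -(eqmx_ortho _ B_eq); apply/orthomx1P.
by rewrite -adjmxE mulmxBl mul1mx -mulmxA B_unitary mulmx1 subrr.
Qed.

Lemma proj_ortho_selfadj : selfadj (proj_ortho A).
Proof. by rewrite /selfadj proj_ortho_schmidt adjmxM adjmxK. Qed.

Lemma retr_proj_ortho : retr (proj_ortho A) = (\rank A)%:R.
Proof. by rewrite proj_ortho_schmidt retr_mulC B_unitary retr1. Qed.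

Lemma proj_ortho_psd : psdmx (proj_ortho A).
Proof. by rewrite proj_ortho_schmidt; exact: psdmx_gram. Qed.

End OrthogonalProjection.

Lemma mxtrace_mul_adj (R : realType) n (A B : 'M[R[i]]_n) :
  \tr (A *m adjmx B) = (mxvec A *m adjmx (mxvec B)) 0 0.
Proof.
rewrite mxE /mxtrace; under eq_bigr do rewrite mxE.
rewrite pair_bigA /= (reindex _ (curry_mxvec_bij n n)) /=.
by apply: eq_bigr => -[i j] _ /=; rewrite !mxE !mxvecE.
Qed.

Section ConditionalExpectation.
Variable R : realType.
Local Notation C := R[i].

Definition star_algebra r m (M : 'A[C]_(r, m)) : Prop :=
  [/\ (1%:M \in M)%MS, (M * M <= M)%MS & forall A, (A \in M)%MS -> (adjmx A \in M)%MS].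

Variables (r m : nat) (M : 'A[C]_(r, m)).
Hypothesis M_algebra : star_algebra M.
Implicit Types (A B S T : 'M[C]_m) (w : 'rV[C]_m).

Let mem1 : (1%:M \in M)%MS. Proof. by case: M_algebra. Qed.

Let memM A B : (A \in M)%MS -> (B \in M)%MS -> (A *m B \in M)%MS.
Proof. by case: M_algebra => _ /mulsmx_subP MM _; exact: MM. Qed.

Let mem_adj A : (A \in M)%MS -> (adjmx A \in M)%MS.
Proof. by case: M_algebra => _ _ adjM; exact: adjM. Qed.

Lemma cent_mxM A B : (A \in 'C(M))%MS -> (B \in 'C(M))%MS -> (A *m B \in 'C(M))%MS.
Proof. exact: (mulsmx_subP (cent_mx_ideal M)) A B. Qed.

Lemma cent_mxB A B : (A \in 'C(M))%MS -> (B \in 'C(M))%MS -> (A - B \in 'C(M))%MS.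
Proof. by move=> A_cent B_cent; rewrite linearB addmx_sub ?eqmx_opp. Qed.

Lemma cent_mx_adj A : (A \in 'C(M))%MS -> (adjmx A \in 'C(M))%MS.
Proof.
move=> /cent_mxP A_cent; apply/cent_mxP => B /mem_adj /A_cent /(congr1 (@adjmx _ _ _)).
by rewrite !adjmxM adjmxK.
Qed.

Lemma cent_mxfun (f : R -> R) A : selfadj A -> (A \in 'C(M))%MS -> (mxfun f A \in 'C(M))%MS.
Proof.
move=> A_selfadj /cent_mxP A_cent; apply/cent_mxP => B B_mem.
by apply/esym/mxfun_comm => //; rewrite /comm_mx A_cent.
Qed.

Lemma proj_ortho_cyclic_cent w :
  (proj_ortho (M *m lin_mul_row w) \in 'C(M))%MS.
Proof.
set L := M *m lin_mul_row w; set Q := proj_ortho L.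
have L_stable A : (A \in M)%MS -> (L *m A <= L)%MS.
  move=> A_mem; apply/row_subP => i; rewrite !row_mul.
  have row_mem : (vec_mx (row i M) \in M)%MS by rewrite vec_mxK row_sub.
  rewrite -[row i M]vec_mxK mul_vec_lin_row -mulmxA -mul_vec_lin_row submxMr //.
  exact: memM.
have QA A : (A \in M)%MS -> Q *m A *m Q = Q *m A.
  move=> A_mem; apply: proj_ortho_id; apply: submx_trans (L_stable A A_mem).
  by rewrite submxMr // proj_orthoE.
have Q_selfadj : selfadj Q := proj_ortho_selfadj L.
clearbody Q.
apply/cent_mxP => A A_mem; rewrite -[RHS]QA //.
have /(congr1 (@adjmx _ _ _)) := QA _ (mem_adj A_mem).
by rewrite !adjmxM adjmxK Q_selfadj mulmxA => ->.
Qed.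

(* Haar averaging over [g] is the Hilbert-Schmidt projection onto the commutant of the
   [u_g ^t n]; defined as such, it needs no integral. *)
Definition cond_exp T : 'M[C]_m := vec_mx (mxvec T *m proj_ortho 'C(M)%MS).

Lemma cond_exp_cent T : (cond_exp T \in 'C(M))%MS.
Proof. by rewrite /cond_exp vec_mxK proj_ortho_sub. Qed.

Lemma cond_exp_sum (I : finType) (F : I -> 'M[C]_m) :
  cond_exp (\sum_i F i) = \sum_i cond_exp (F i).
Proof. by rewrite /cond_exp linear_sum mulmx_suml linear_sum. Qed.

Lemma mxtrace_cond_exp A T : (A \in 'C(M))%MS -> \tr (cond_exp T *m A) = \tr (T *m A).
Proof.
move=> A_cent; rewrite -[A]adjmxK !mxtrace_mul_adj vec_mxK.
have projA : mxvec (adjmx A) *m proj_ortho 'C(M)%MS = mxvec (adjmx A).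
  exact/proj_ortho_id/cent_mx_adj.
by rewrite -[in RHS]projA adjmxM proj_ortho_selfadj mulmxA.
Qed.

Lemma retr_cond_exp A T : (A \in 'C(M))%MS -> retr (cond_exp T *m A) = retr (T *m A).
Proof. by move=> A_cent; rewrite /retr mxtrace_cond_exp. Qed.

Lemma cond_exp_selfadj T : selfadj T -> selfadj (cond_exp T).
Proof.
move=> T_selfadj; set S := cond_exp T; apply/subr0_eq/retr_mul_adj_eq0.
have S_cent : (S \in 'C(M))%MS := cond_exp_cent T.
have D_cent : (adjmx (adjmx S - S) \in 'C(M))%MS.
  by apply/cent_mx_adj/cent_mxB/S_cent/cent_mx_adj.
move: (adjmx (adjmx S - S)) D_cent => D D_cent.
rewrite mulmxBl raddfB /= retr_cond_exp // -retr_adj adjmxM adjmxK retr_mulC.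
rewrite retr_cond_exp; last exact: cent_mx_adj.
by rewrite -(retr_adj (T *m D)) adjmxM T_selfadj (retr_mulC (adjmx D)) subrr.
Qed.

Lemma cond_exp_psd T : psdmx T -> psdmx (cond_exp T).
Proof.
move=> T_psd; set S := cond_exp T.
have S_selfadj : selfadj S by exact/cond_exp_selfadj/psdmx_selfadj.
pose pos (s : R) := Num.max s 0; pose neg (s : R) := Num.max (- s) 0.
have neg_ge0 s : 0 <= neg s by rewrite le_max lexx orbT.
have trSN_ge0 : 0 <= retr (S *m mxfun neg S).
  rewrite retr_cond_exp; last exact/cent_mxfun/cond_exp_cent.
  by apply: retr_psdmx_mul_ge0 => //; exact: mxfun_psd.
have SN : S *m mxfun neg S = - (mxfun neg S *m adjmx (mxfun neg S)).
  rewrite mxfun_selfadj -{1}(mxfun_id S_selfadj) -!mxfunM -mxfunN.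
  by apply: eq_mxfun => i; rewrite /neg /=; case: ltP => _; ring.
have neg0 : mxfun neg S = 0.
  apply/retr_mul_adj_eq0/eqP; rewrite eq_le retr_mul_adj_ge0 andbT.
  by rewrite -oppr_ge0 -raddfN -SN.
have -> : S = mxfun (fun s => pos s - neg s) S.
  rewrite -{1}(mxfun_id S_selfadj); apply: eq_mxfun => i; rewrite /pos /neg /=.
  by case: ltP => s_sign; case: ltP => Ns_sign; lra.
by rewrite mxfunB neg0 subr0; apply: mxfun_psd => i; rewrite le_max lexx orbT.
Qed.

Lemma mul_mxsupp_cond_exp T : psdmx T -> T *m mxsupp (cond_exp T) = T.
Proof.
move=> T_psd; set S := cond_exp T; have S_selfadj := psdmx_selfadj (cond_exp_psd T_psd).
have compl_cent : (1%:M - mxsupp S \in 'C(M))%MS.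
  by rewrite cent_mxB ?scalar_mx_cent // cent_mxfun // cond_exp_cent.
apply/eqP; rewrite eq_sym -subr_eq0 -{1}[T]mulmx1 -mulmxBr; apply/eqP.
apply: psdmx_mul_orthoprojmx_eq0 => //.
  by rewrite spectral_projC; exact: spectral_proj_orthoprojmx.
by rewrite -retr_cond_exp // mulmxBr mulmx1 mul_mxsupp // subrr raddf0.
Qed.

(* The trace below only sees the range of [w M], a cyclic subspace of dimension at most
   [\rank M] whose projection lies in the commutant. *)
Lemma retr_gram_mul_mxpinv_le w (T := adjmx w *m w) :
  retr (T *m mxpinv (cond_exp T)) <= (\rank M)%:R.
Proof.
set S := cond_exp T; set L := M *m lin_mul_row w; set Q := proj_ortho L.
have S_selfadj : selfadj S by exact/psdmx_selfadj/cond_exp_psd/psdmx_gram.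
have wQ : w *m Q = w.
  by apply: proj_ortho_id; rewrite -{1}[w]mulmx1 -mul_vec_lin_row (submxMr _ mem1).
have QS_cent : (Q *m mxpinv S \in 'C(M))%MS.
  by rewrite cent_mxM ?proj_ortho_cyclic_cent // cent_mxfun // cond_exp_cent.
have -> : retr (T *m mxpinv S) = retr (Q *m mxsupp S).
  have TQ : T *m Q = T by rewrite -mulmxA wQ.
  have -> : T *m mxpinv S = T *m (Q *m mxpinv S) by rewrite (mulmxA T Q) TQ.
  by rewrite -(retr_cond_exp T QS_cent) retr_mulC -mulmxA (mxpinv_mul S_selfadj).
apply: (@le_trans _ _ (retr Q)); last first.
  by rewrite retr_proj_ortho ler_nat mxrankM_maxl.
rewrite -{2}[Q]mulmx1; apply: ler_retr_mull; first exact: proj_ortho_psd.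
by rewrite /lemx spectral_projC; exact: spectral_proj_psd.
Qed.

Lemma psdmx_le_cond_exp T : psdmx T -> T <=m (\rank M)%:R%:C%C *: cond_exp T.
Proof.
move=> T_psd; have /psdmx_factor[Y TE] := T_psd.
have gramE : adjmx Y *m Y = \sum_i adjmx (row i Y) *m row i Y.
  apply/matrixP => k l; rewrite summxE mxE; apply: eq_bigr => i _.
  by rewrite !mxE big_ord1 !mxE.
apply: lemx_mxform => [||x].
- exact: psdmx_selfadj.
- exact/selfadjZ/psdmx_selfadj/cond_exp_psd.
rewrite mxform_mxZ TE gramE cond_exp_sum !mxform_mx_sum mulr_sumr.
apply: ler_sum => i _; set G := adjmx (row i Y) *m row i Y.
have G_psd : psdmx G by exact: psdmx_gram.
have EG_psd := cond_exp_psd G_psd.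
have := psdmx_le_retr_mxpinv G_psd EG_psd (mul_mxsupp_cond_exp G_psd).
move/(mxform_lemx x)/le_trans; apply; rewrite mxform_mxZ.
by rewrite ler_wpM2r ?psdmx_form_ge0 // retr_gram_mul_mxpinv_le.
Qed.

End ConditionalExpectation.

Section CommutantTest.
Variable R : realType.
Local Notation C := R[i].

Lemma ex_commutant_test r m (M : 'A[C]_(r, m)) (T rho0 rho1 : 'M[C]_m) (k : nat) (lam : R) :
  star_algebra M -> (\rank M <= k)%N -> (0 < k)%N -> 0 < lam -> quantum_test T ->
  density rho0 -> psdmx rho1 -> (rho1 \in 'C(M))%MS ->
  exists T', [/\ (T' \in 'C(M))%MS, quantum_test T',
    retr (rho0 *m (1%:M - T')) <= 2 * (retr (rho0 *m (1%:M - T)) + k%:R * lam) &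
    retr (rho1 *m T') <= lam^-1 * retr (rho1 *m T)].
Proof.
move=> M_algebra rank_le k_gt0 lam_gt0 T_test [rho0_psd rho0_tr] rho1_psd rho1_cent.
set S := cond_exp M T; have S_psd : psdmx S := cond_exp_psd M_algebra T_test.1.
have T_leS : T <=m k%:R%:C%C *: S.
  apply: lemx_mxform => [||x].
  - exact: psdmx_selfadj T_test.1.
  - exact/selfadjZ/psdmx_selfadj.
  have := mxform_lemx x (psdmx_le_cond_exp M_algebra T_test.1).
  by rewrite !mxform_mxZ => /le_trans; apply; rewrite ler_wpM2r ?ler_nat ?psdmx_form_ge0.
exists (spectral_test lam S); split.
- exact/cent_mxfun/cond_exp_cent/psdmx_selfadj.
- exact: quantum_test_spectral.
- have kR_gt0 : 0 < k%:R :> R by rewrite ltr0n.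
  have := spectral_test_compl_le kR_gt0 lam_gt0 (psdmx_selfadj S_psd) T_test T_leS.
  move/(ler_retr_mull rho0_psd)/le_trans; apply.
  rewrite -scalemxAr retrZ (mulmxDr rho0 (1%:M - T)) raddfD /= -scalemxAr mulmx1 retrZ.
  by rewrite /retr rho0_tr mulr1.
have := ler_retr_mull rho1_psd (spectral_test_le lam_gt0 S_psd).
by rewrite -scalemxAr retrZ retr_mulC (retr_mulC rho1 S) retr_cond_exp // (retr_mulC T).
Qed.

End CommutantTest.

(** * The algebra spanned by tensor powers *)

Lemma ex_spanning_rows (F : fieldType) n (P : 'rV[F]_n -> Prop) :
  exists (r : nat) (A : 'M[F]_(r, n)),
    (forall i, P (row i A)) /\ forall x, P x -> (x <= A)%MS.
Proof.
pose rank_attained k := `[< exists r (A : 'M[F]_(r, n)), (forall i, P (row i A)) /\ \rank A = k >].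
have ex_rank : exists k, rank_attained k.
  by exists 0%N; apply/asboolP; exists 0%N, 0; split=> [[]|]; rewrite ?mxrank0.
have rank_le k : rank_attained k -> (k <= n)%N.
  by move=> /asboolP[r [A [_ <-]]]; exact: rank_leq_col.
case: (ex_maxnP ex_rank rank_le) => k /asboolP[r [A [PA rankA]]] rank_max.
exists r, A; split=> // x Px.
have : rank_attained (\rank (col_mx A x)).
  apply/asboolP; exists (r + 1)%N, (col_mx A x); split=> // i.
  by case: (split_ordP i) => j ->; rewrite ?rowKu ?rowKd ?ord1 ?row_id.
move/rank_max; rewrite -rankA => rank_le_A.
have A_le : (A <= col_mx A x)%MS by rewrite -addsmxE addsmxSl.
have := mxrank_leqif_sup A_le => -[_]; rewrite eqn_leq mxrankS //= rank_le_A => /esym.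
by apply: submx_trans; rewrite -addsmxE addsmxSr.
Qed.

Lemma ex_spanning_algebra (R : realType) m (P : 'M[R[i]]_m -> Prop) :
  P 1%:M -> (forall U V, P U -> P V -> P (U *m V)) -> (forall U, P U -> P (adjmx U)) ->
  exists r (M : 'A[R[i]]_(r, m)), [/\ star_algebra M,
    forall U, P U -> (U \in M)%MS & forall i, P (vec_mx (row i M))].
Proof.
move=> P1 PM Padj.
have [r [M [PrM P_M]]] := ex_spanning_rows (fun x => P (vec_mx x)).
have P_mem U : P U -> (U \in M)%MS by move=> PU; apply: P_M; rewrite mxvecK.
exists r, M; split=> //; split; first exact: P_mem.
  apply/sumsmx_subP => i _; rewrite genmxE; apply/row_subP => j.
  by rewrite row_mul mul_rV_lin; exact/P_mem/PM.
move=> A /submxP[a AE].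
have -> : adjmx A = \sum_i Num.conj (a 0 i) *: adjmx (vec_mx (row i M)).
  rewrite -[A]mxvecK AE mulmx_sum_row linear_sum.
  apply/matrixP => k l; rewrite !mxE !summxE rmorph_sum.
  by apply: eq_bigr => i _; rewrite linearZ !mxE rmorphM.
rewrite linear_sum; apply: summx_sub => i _; rewrite linearZ scalemx_sub //.
exact/P_mem/Padj.
Qed.

Section TensorPowers.
Variable F : comNzRingType.

Lemma tensmx1 m n : (1%:M : 'M[F]_m) *t (1%:M : 'M[F]_n) = 1%:M.
Proof.
apply/matrixP => i j; case: (mxtens_indexP i) => i0 i1; case: (mxtens_indexP j) => j0 j1.
rewrite tensmxE !mxE -natrM mulnb (can_eq (@mxtens_indexK _ _)).
by rewrite xpair_eqE.
Qed.

Lemma mxtrace_tens m n (A : 'M[F]_m) (B : 'M[F]_n) : \tr (A *t B) = \tr A * \tr B.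
Proof. by rewrite /mxtrace mulr_sum; apply: eq_bigr => i _; rewrite mxE. Qed.

Lemma ntensmxM d n (A B : 'M[F]_d) : (A *m B) ^t n = A ^t n *m B ^t n.
Proof.
case: n => [|n]; first by rewrite !ntensmx0 mulmx1.
by elim: n => [|n IHn]; rewrite ?ntensmx1 // !ntensmxSS IHn tensmx_mul.
Qed.

Lemma ntens1mx d n : (1%:M : 'M[F]_d) ^t n = 1%:M.
Proof.
case: n => [|n] //.
by elim: n => [|n IHn]; rewrite ?ntensmx1 // !ntensmxSS IHn tensmx1.
Qed.

Lemma mxtrace_ntens d n (A : 'M[F]_d) : \tr (A ^t n) = \tr A ^+ n.
Proof.
case: n => [|n]; first by rewrite ntensmx0 mxtrace1.
by elim: n => [|n IHn]; rewrite ?ntensmx1 // ntensmxSS mxtrace_tens IHn -exprS.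
Qed.

Lemma ntensmx_monomial d n (i j : 'I_(d ^ n.+1)) :
  exists t : {ffun 'I_d * 'I_d -> 'I_n.+2}, forall A : 'M[F]_d,
    (A ^t n.+1) i j = \prod_p A p.1 p.2 ^+ t p.
Proof.
elim: n i j => [|n IHn].
  move=> i j; exists [ffun q => inord (q == (i, j))] => A; rewrite ntensmx1.
  rewrite (bigD1 (i, j)) //= ffunE eqxx inordK // expr1 big1 ?mulr1 // => q q_neq.
  by rewrite ffunE (negPf q_neq) inordK.
move=> i j; case: (mxtens_indexP i) => i0 i1; case: (mxtens_indexP j) => j0 j1.
have [t tE] := IHn i1 j1.
exists [ffun q => inord ((q == (i0, j0)) + t q)] => A.
have t_lt q : ((q == (i0, j0)) + t q < n.+3)%N.
  by have := ltn_ord (t q); case: (q == _) => /=; lia.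
rewrite ntensmxSS tensmxE tE (bigD1 (i0, j0)) // [in RHS](bigD1 (i0, j0)) //=.
rewrite mulrA; congr (_ * _); first by rewrite ffunE inordK // eqxx add1n exprS.
by apply: eq_bigr => q q_neq; rewrite ffunE inordK // (negPf q_neq).
Qed.

End TensorPowers.

Lemma ntensmx_span (F : fieldType) d n :
  exists W : 'M[F]_(n.+2 ^ (d * d), d ^ n.+1 * d ^ n.+1),
    forall A : 'M[F]_d, (mxvec (A ^t n.+1) <= W)%MS.
Proof.
pose I := {ffun 'I_d * 'I_d -> 'I_n.+2}.
have [t tE] := choice (fun ij : 'I_(d ^ n.+1) * 'I_(d ^ n.+1) =>
  ntensmx_monomial F ij.1 ij.2).
have card_I : #|{: I}| = (n.+2 ^ (d * d))%N by rewrite card_ffun card_prod !card_ord.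
rewrite -card_I; pose E s : 'M[F]_(d ^ n.+1) := \matrix_(i, j) (t (i, j) == s)%:R.
exists (\matrix_k mxvec (E (enum_val k))) => A.
have -> : A ^t n.+1 = \sum_(s : I) (\prod_p A p.1 p.2 ^+ s p) *: E s.
  apply/matrixP => i j; rewrite (tE (i, j)) summxE (bigD1 (t (i, j))) //=.
  rewrite [X in _ + X]big1 ?addr0 => [|s s_neq].
    by rewrite !mxE eqxx mulr1.
  by rewrite !mxE eq_sym (negPf s_neq) mulr0.
rewrite linear_sum; apply: summx_sub => s _; rewrite linearZ scalemx_sub //.
by apply: submx_trans (row_sub (enum_rank s) _); rewrite rowK enum_rankK.
Qed.

Section TensorPowerRepresentation.
Variable R : realType.
Local Notation C := R[i].

Lemma adjmx_ntens d n (A : 'M[C]_d) : adjmx (A ^t n) = adjmx A ^t n.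
Proof.
case: n => [|n]; first by rewrite !ntensmx0 adjmx1.
elim: n => [|n IHn]; rewrite ?ntensmx1 // !ntensmxSS -IHn /adjmx.
by rewrite map_mxT trmx_tens.
Qed.

Lemma psdmx_ntens d n (A : 'M[C]_d) : psdmx A -> psdmx (A ^t n).
Proof.
by move=> /psdmx_factor[Y ->]; rewrite ntensmxM -adjmx_ntens; exact: psdmx_gram.
Qed.

Lemma density_ntens d n (A : 'M[C]_d) : density A -> density (A ^t n).
Proof. by move=> [/psdmx_ntens A_psd trA]; split; rewrite // mxtrace_ntens trA expr1n. Qed.

Variables (G : Type) (mul : G -> G -> G) (inv : G -> G) (e : G).
Variables (d : nat) (u : G -> 'M[C]_d).
Hypotheses (uM : forall g h, u (mul g h) = u g *m u h) (u1 : u e = 1%:M).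
Hypothesis uV : forall g, u (inv g) = adjmx (u g).

Lemma ex_tensor_power_algebra n : exists r (M : 'A[C]_(r, d ^ n.+1)),
  [/\ star_algebra M, (\rank M <= n.+2 ^ (d * d))%N &
    forall T, (T \in 'C(M))%MS <-> in_An u T].
Proof.
have [] := @ex_spanning_algebra _ _ (fun U => exists g, U = u g ^t n.+1).
- by exists e; rewrite u1 ntens1mx.
- by move=> _ _ [g ->] [h ->]; exists (mul g h); rewrite uM ntensmxM.
- by move=> _ [g ->]; exists (inv g); rewrite uV adjmx_ntens.
move=> r [M [M_algebra u_mem rows_M]]; exists r, M; split=> //.
  have [W u_le] := ntensmx_span C d n.
  apply: leq_trans (rank_leq_row W); apply/mxrankS/row_subP => i.
  by have [g rowE] := rows_M i; rewrite -[row i M]vec_mxK rowE.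
move=> T; split=> [/cent_mxP T_cent g|Tu]; first by apply/esym/T_cent/u_mem; exists g.
by apply/cent_rowP => i; have [g ->] := rows_M i.
Qed.

End TensorPowerRepresentation.

(** * Minimal error probabilities *)

Lemma ler_sqrt_tradeoff (R : rcfType) (a k y : R) : 0 <= a <= 1 -> 1 <= k ->
  (forall lam, 0 < lam -> y <= (2 + lam^-1) * a + 2 * (k * lam)) ->
  y <= 5 * k * Num.sqrt a.
Proof.
move=> /andP[]; rewrite le_eqVlt => /predU1P[<- _ k_ge1 y_le|a_gt0 a_le1 k_ge1 y_le].
  rewrite sqrtr0 mulr0; apply/ler_addgt0Pr => eps eps_gt0.
  have k_gt0 : 0 < 2 * k by lra.
  apply: le_trans (y_le (eps / (2 * k)) (divr_gt0 eps_gt0 k_gt0)) _.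
  by rewrite mulr0 !add0r mulrA mulrC divfK // gt_eqF.
have s_gt0 : 0 < Num.sqrt a by rewrite sqrtr_gt0.
have s_le1 : Num.sqrt a <= 1 by rewrite -sqrtr1 ler_wsqrtr.
apply: le_trans (y_le _ s_gt0) _; rewrite -{2}(sqr_sqrtr (ltW a_gt0)).
move: s_gt0 s_le1; set s := Num.sqrt a => s_gt0 s_le1.
have -> : (2 + s^-1) * s ^+ 2 = (2 * s + 1) * s by field; rewrite gt_eqF.
nra.
Qed.

Section MinimalErrors.
Variable R : realType.
Local Notation C := R[i].
Variables (d : nat) (rho0 rho1 : 'M[C]_d).
Hypotheses (rho0_density : density rho0) (rho1_density : density rho1).

Lemma perrE n (T : 'M[C]_(d ^ n)) :
  perr rho0 rho1 T = retr (rho0 ^t n *m (1%:M - T)) + retr (rho1 ^t n *m T).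
Proof. by rewrite /perr raddfD. Qed.

Lemma perr_terms_ge0 n (T : 'M[C]_(d ^ n)) : quantum_test T ->
  0 <= retr (rho0 ^t n *m (1%:M - T)) /\ 0 <= retr (rho1 ^t n *m T).
Proof.
move=> [T_psd T_le1]; split.
  exact: retr_psdmx_mul_ge0 (psdmx_ntens n rho0_density.1) T_le1.
exact: retr_psdmx_mul_ge0 (psdmx_ntens n rho1_density.1) T_psd.
Qed.

Lemma perr_ge0 n (T : 'M[C]_(d ^ n)) : quantum_test T -> 0 <= perr rho0 rho1 T.
Proof. by rewrite perrE => /perr_terms_ge0[] ? ?; exact: addr_ge0. Qed.

Lemma perr0 n : perr rho0 rho1 (0 : 'M[C]_(d ^ n)) = 1.
Proof.
by rewrite perrE subr0 mulmx1 mulmx0 raddf0 addr0 /retr (density_ntens n rho0_density).2.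
Qed.

Lemma Pmin_full_ge n x :
  (forall T : 'M[C]_(d ^ n), quantum_test T -> x <= perr rho0 rho1 T) ->
  x <= Pmin_full rho0 rho1 n.
Proof.
move=> x_le; apply: lb_le_inf => [|_ [T T_test <-]]; last exact: x_le.
by exists (perr rho0 rho1 (0 : 'M[C]_(d ^ n))), 0 => //; exact: quantum_test0.
Qed.

Lemma Pmin_full_le n (T : 'M[C]_(d ^ n)) :
  quantum_test T -> Pmin_full rho0 rho1 n <= perr rho0 rho1 T.
Proof.
by move=> T_test; apply: ge_inf; [exists 0 => _ [? ? <-]; exact: perr_ge0 | exists T].
Qed.

Lemma Pmin_full_ge0 n : 0 <= Pmin_full rho0 rho1 n.
Proof. by apply: Pmin_full_ge => T; exact: perr_ge0. Qed.

Lemma Pmin_full_le1 n : Pmin_full rho0 rho1 n <= 1.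
Proof. by rewrite -(perr0 n); apply/Pmin_full_le/quantum_test0. Qed.

Section InvariantTests.
Variables (G : Type) (u : G -> 'M[C]_d).

Lemma Pmin_inv_le n (T : 'M[C]_(d ^ n)) : in_An u T -> quantum_test T ->
  Pmin_inv u rho0 rho1 n <= perr rho0 rho1 T.
Proof.
move=> T_inv [T_psd T_le1]; apply: ge_inf; last by exists T.
by exists 0 => _ [T' [_ ? ?] <-]; exact: perr_ge0.
Qed.

Lemma Pmin_full_le_inv n : Pmin_full rho0 rho1 n <= Pmin_inv u rho0 rho1 n.
Proof.
apply: lb_le_inf => [|_ [T [_ T_psd T_le1] <-]]; last exact: Pmin_full_le.
have [null_psd null_le1] := quantum_test0 R (d ^ n).
by exists (perr rho0 rho1 (0 : 'M[C]_(d ^ n))), 0 => //; split=> // g; rewrite mulmx0 mul0mx.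
Qed.

End InvariantTests.

Variables (G : Type) (mul : G -> G -> G) (inv : G -> G) (e : G) (u : G -> 'M[C]_d).
Hypotheses (uM : forall g h, u (mul g h) = u g *m u h) (u1 : u e = 1%:M).
Hypothesis uV : forall g, u (inv g) = adjmx (u g).
Hypothesis rho1_inv : forall g, rho1 *m u g = u g *m rho1.

Lemma Pmin_inv_le_full n (lam : R) : 0 < lam ->
  Pmin_inv u rho0 rho1 n.+1 <=
    (2 + lam^-1) * Pmin_full rho0 rho1 n.+1 + 2 * ((n.+2 ^ (d * d))%:R * lam).
Proof.
move=> lam_gt0; set k := (n.+2 ^ (d * d))%N.
have c_gt0 : 0 < 2 + lam^-1 by rewrite addr_gt0 ?invr_gt0.
rewrite -lerBlDr [leRHS]mulrC -ler_pdivrMr //; apply: Pmin_full_ge => T T_test.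
rewrite ler_pdivrMr // lerBlDr.
have [r [M [M_algebra rank_le cent_in_An]]] := ex_tensor_power_algebra uM u1 uV n.
have rho1_cent : (rho1 ^t n.+1 \in 'C(M))%MS.
  by apply/cent_in_An => g; rewrite -!ntensmxM rho1_inv.
have k_gt0 : (0 < k)%N by rewrite expn_gt0.
have [T' [/cent_in_An T'_inv T'_test err0 err1]] :=
  ex_commutant_test M_algebra rank_le k_gt0 lam_gt0 T_test
    (density_ntens n.+1 rho0_density) (psdmx_ntens n.+1 rho1_density.1) rho1_cent.
apply: le_trans (Pmin_inv_le T'_inv T'_test) _.
have [err0_ge0 err1_ge0] := perr_terms_ge0 T_test.
rewrite !perrE; apply: le_trans (lerD err0 err1) _.
have : 0 <= lam^-1 * retr (rho0 ^t n.+1 *m (1%:M - T)).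
  by rewrite mulr_ge0 ?invr_ge0 ?(ltW lam_gt0).
lra.
Qed.

Lemma Pmin_inv_le_sqrt n :
  Pmin_inv u rho0 rho1 n.+1 <= 5 * (n.+2 ^ (d * d))%:R * Num.sqrt (Pmin_full rho0 rho1 n.+1).
Proof.
apply: ler_sqrt_tradeoff => [||lam]; last exact: Pmin_inv_le_full.
  by rewrite Pmin_full_ge0 Pmin_full_le1.
by rewrite ler1n expn_gt0.
Qed.

End MinimalErrors.

(** * Exponential rates *)

Section Rates.
Variable R : realType.
Local Open Scope classical_set_scope.

Lemma le_limn_esup (a b : (\bar R)^nat) :
  (\forall n \near \oo, (a n <= b n)%E) -> (limn_esup a <= limn_esup b)%E.
Proof.
move=> [N _ ab]; rewrite !limn_esup_lim.
apply: lee_lim; [exact: is_cvg_esups | exact: is_cvg_esups|].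
exists N => // n Nn; apply: ge_ereal_sup => _ [k /= nk <-].
by apply: le_trans (ab k (leq_trans Nn nk)) _; apply: ereal_sup_ubound; exists k.
Qed.

Lemma le_limn_einf (a b : (\bar R)^nat) :
  (\forall n \near \oo, (a n <= b n)%E) -> (limn_einf a <= limn_einf b)%E.
Proof.
move=> ab; rewrite /limn_einf leeN2; apply: le_limn_esup.
by apply: filterS ab => n; rewrite leeN2.
Qed.

Lemma le_elog (x y : R) : x <= y -> (elog x <= elog y)%E.
Proof.
rewrite /elog => xy; case: ltP => [x_gt0|_]; last by rewrite leNye.
have y_gt0 := lt_le_trans x_gt0 xy.
by rewrite y_gt0 lee_fin ler_ln ?posrE.
Qed.

Lemma le_rate (P Q : nat -> R) n : P n <= Q n -> (rate P n <= rate Q n)%E.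
Proof. by move=> PQ; rewrite /rate lee_wpmul2l ?lee_fin ?invr_ge0 // le_elog. Qed.

Lemma rate_mul_sqrt (c P : nat -> R) n : (0 < n)%N -> 0 < c n -> 0 <= P n ->
  (rate (fun k => c k * Num.sqrt (P k))%R n =
   (ln (c n) / n%:R)%:E + (2%:R^-1)%:E * rate P n)%E.
Proof.
move=> n_gt0 c_gt0; have n_pos : (0 < (n%:R)^-1%:E :> \bar R)%E.
  by rewrite lte_fin invr_gt0 ltr0n.
rewrite /rate /elog le_eqVlt => /predU1P[<-|P_gt0].
  by rewrite sqrtr0 mulr0 ltxx (gt0_muleNy n_pos) gt0_muleNy ?addeNy // lte_fin invr_gt0.
have sqrtP_gt0 : 0 < Num.sqrt (P n) by rewrite sqrtr_gt0.
have -> : ln (P n) = 2 * ln (Num.sqrt (P n)).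
  by rewrite -{1}(sqr_sqrtr (ltW P_gt0)) lnXn // mulr_natl.
rewrite P_gt0 mulr_gt0 // lnM ?posrE // -!EFinM -EFinD; congr (_%:E).
by field; rewrite pnatr_eq0 -lt0n.
Qed.

Lemma ln_le_mul_sqrt (x : R) : 0 < x -> ln x <= 2 * Num.sqrt x.
Proof.
move=> x_gt0; rewrite -{1}(sqr_sqrtr (ltW x_gt0)) lnXn ?sqrtr_gt0 //.
by rewrite -[ln _ *+ _]mulr_natl ler_pM2l // ltW // ln_sublinear // sqrtr_gt0.
Qed.

Lemma cvg_invn : (fun n => n%:R^-1 : R) @ \oo --> (0 : R).
Proof. by rewrite -cvg_shiftS /=; exact: cvg_harmonic. Qed.

Lemma cvg_ln_div : (fun n => ln (n.+1%:R : R) / n%:R) @ \oo --> (0 : R).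
Proof.
rewrite -cvg_shiftS /=.
have sqrt_cvg : (fun n => 4 * Num.sqrt (n.+1%:R^-1 : R)) @ \oo --> (0 : R).
  rewrite -[0 in X in _ --> X](mulr0 4) -[0 in X in _ --> X]sqrtr0; apply: cvgMl_tmp.
  by apply: continuous_cvg; [exact: sqrt_continuous | exact: cvg_harmonic].
apply: squeeze_cvgr (cvg_cst 0) sqrt_cvg; apply: nearW => n /=.
have n_gt0 : 0 < n.+1%:R :> R by rewrite ltr0n.
rewrite divr_ge0 ?ln_ge0 ?ler1n //= ler_pdivrMr //.
apply: le_trans (ln_le_mul_sqrt _) _; first by rewrite ltr0n.
have -> : 4 * Num.sqrt n.+1%:R^-1 * n.+1%:R = 2 * (2 * Num.sqrt n.+1%:R) :> R.
  rewrite sqrtrV ?ltW // -[X in _ * _ * X](sqr_sqrtr (ltW n_gt0)).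
  by field; rewrite gt_eqF // sqrtr_gt0.
have two_sqrt : 2 = Num.sqrt (2 ^+ 2) :> R by rewrite sqrtr_sqr ger0_norm.
rewrite ler_pM2l // {1}two_sqrt -sqrtrM // ler_wsqrtr // -natrX -natrM ler_nat; lia.
Qed.

Lemma cvg_ln_poly_div (a : R) D : 0 < a ->
  (fun n => ln (a * (n.+1 ^ D)%:R) / n%:R) @ \oo --> (0 : R).
Proof.
move=> a_gt0.
have -> : (fun n => ln (a * (n.+1 ^ D)%:R) / n%:R) =
    (fun n => ln a * n%:R^-1 + D%:R * (ln (n.+1%:R : R) / n%:R)).
  apply/funext => n; rewrite natrX lnM ?posrE ?exprn_gt0 ?ltr0n // lnXn ?ltr0n //.
  by rewrite mulrDl -[ln _ *+ _]mulr_natl mulrA.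
have -> : 0 = ln a * 0 + D%:R * 0 :> R by rewrite !mulr0 addr0.
by apply: cvgD; apply: cvgMl_tmp; [exact: cvg_invn | exact: cvg_ln_div].
Qed.

Lemma limn_esup_rate_le_sqrt (P Q c : nat -> R) :
  (forall n, 0 < c n) -> (fun n => ln (c n) / n%:R) @ \oo --> (0 : R) ->
  (forall n, 0 <= P n) -> (forall n, Q n.+1 <= c n.+1 * Num.sqrt (P n.+1)) ->
  cvgn (rate P) -> (limn_esup (rate Q) <= (2%:R^-1)%:E * limn (rate P))%E.
Proof.
move=> c_gt0 c_subexp P_ge0 QP P_cvg.
pose b n : \bar R := ((ln (c n) / n%:R)%:E + (2%:R^-1)%:E * rate P n)%E.
have b_cvg : b @ \oo --> ((2%:R^-1)%:E * limn (rate P))%E.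
  rewrite -[X in _ --> X]add0e; apply: cvgeD; first by rewrite fin_num_adde_defr.
    by apply/fine_cvgP; split; [exact: nearW | exact: c_subexp].
  exact: cvgeZl.
rewrite -(cvg_limn_einf_sup b_cvg).2; apply: le_limn_esup.
exists 1%N => // -[//|n] _; rewrite /b -rate_mul_sqrt //.
exact: le_rate.
Qed.

End Rates.

Theorem theorem5p5 (R : realType) (d : nat) (G : topologicalType)
  (mul : G -> G -> G) (inv : G -> G) (e : G) (u : G -> 'M[R[i]]_d)
  (rho0 rho1 : 'M[R[i]]_d) :
  compact_unitary_rep mul inv e u ->
  density rho0 -> density rho1 ->
  (forall g, rho1 *m u g = u g *m rho1) ->
  cvgn (rate (Pmin_full rho0 rho1)) ->
  [/\ (limn (rate (Pmin_full rho0 rho1)) <= limn_einf (rate (Pmin_inv u rho0 rho1)))%E,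
      (limn_einf (rate (Pmin_inv u rho0 rho1)) <= limn_esup (rate (Pmin_inv u rho0 rho1)))%E &
      (limn_esup (rate (Pmin_inv u rho0 rho1))
         <= (2%:R^-1)%:E * limn (rate (Pmin_full rho0 rho1)))%E].
Proof.
move=> [[_ [_ mulV]] [_ [_ [[uM u1] [uU _]]]]] dens0 dens1 rho1_inv cvg_full.
have uV g : u (inv g) = adjmx (u g).
  have /mulmx1C uVu := uU g.
  by rewrite -[LHS]mul1mx -uVu -mulmxA -uM (mulV g).2 u1 mulmx1.
split; last 1 first.
- apply: (limn_esup_rate_le_sqrt (c := fun n => 5 * (n.+1 ^ (d * d))%:R)) cvg_full => [n||n|n].
  + by rewrite mulr_gt0 // ltr0n expn_gt0.
  + exact: cvg_ln_poly_div.
  + exact: (Pmin_full_ge0 dens0 dens1).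
  + exact: (Pmin_inv_le_sqrt dens0 dens1 uM u1 uV rho1_inv).
- rewrite -(is_cvg_limn_einfE cvg_full); apply: le_limn_einf; apply: nearW => n.
  exact/le_rate/(Pmin_full_le_inv dens0 dens1).
exact: limn_einf_sup.
Qed.
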